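(* Consider the network flow dual problem described in the context, with constants $\gamma,\Gamma,\delta$, unweighted Laplacian $\mathcal{L}$, and $B=\frac{\mu_n(\mathcal{L})\,\delta}{\gamma\sqrt{\mu_2(\mathcal{L})}}$, where $\mu_n(\mathcal{L})$ and $\mu_2(\mathcal{L})$ are the largest and second smallest eigenvalues of $\mathcal{L}$. Let $\epsilon\in\left(0,\frac{\mu_2(\mathcal{L})}{\mu_n(\mathcal{L})}\sqrt{\frac{\gamma}{\Gamma}}\right)$ be the precision parameter of the solver used to compute approximate Newton directions $\tilde{d}_k$, and let $$\alpha^*=\frac{e^{-\epsilon^2}}{(1+\epsilon)^2}\left(\frac{\gamma}{\Gamma}\,\frac{\mu_2(\mathcal{L})}{\mu_n(\mathcal{L})}\right)^2 .$$ Put $$\xi=\sqrt{1-\alpha^*+\alpha^*\epsilon\frac{\mu_n(\mathcal{L})}{\mu_2(\mathcal{L})}\sqrt{\frac{\Gamma}{\gamma}}},\qquad \zeta=\frac{B\,(\alpha^*\Gamma(1+\epsilon))^2}{2\mu_2^2(\mathcal{L})},\qquad \eta_0=\frac{\xi(1-\xi)}{\zeta},\qquad \eta_1=\frac{1-\xi}{\zeta}.$$ Then the iteration $\lambda_{k+1}=\lambda_k+\alpha^*\tilde{d}_k$ (from any $\lambda_0$), with $g_k=\nabla q(\lambda_k)$, has the following three phases of convergence. (1) Strict decrease phase: whenever $\|g_k\|_{\mathcal{L}}\ge\eta_1$, $$q(\lambda_{k+1})-q(\lambda_k)\le-\frac12\,\frac{e^{-2\epsilon^2}}{(1+\epsilon)^2}\,\frac{\gamma^3}{\Gamma^2}\,\frac{\mu_2^2(\mathcal{L})}{\mu_n^4(\mathcal{L})}\,\eta_1^2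 .$$ (2) Quadratic decrease phase: whenever $\eta_0\le\|g_k\|_{\mathcal{L}}<\eta_1$, $$\|g_{k+1}\|_{\mathcal{L}}\le\frac{1}{\eta_1}\|g_k\|_{\mathcal{L}}^2 .$$ (3) Terminal phase: whenever $\|g_k\|_{\mathcal{L}}\le\eta_0$, $$\|g_{k+1}\|_{\mathcal{L}}\le\sqrt{1-\alpha^*+\alpha^*\epsilon\frac{\mu_n(\mathcal{L})}{\mu_2(\mathcal{L})}\sqrt{\frac{\Gamma}{\gamma}}}\;\|g_k\|_{\mathcal{L}} .$$
   Context: Network: a directed graph $\mathcal{G}$ with $n$ nodes and edge set $\mathcal{E}$, whose underlying undirected graph is connected, non-bipartite, and has algebraic connectivity bounded below by a constant $\omega>0$. $A\in\mathbb{R}^{n\times|\mathcal{E}|}$ is the node-edge incidence matrix ($A_{i,e}=1$ if edge $e$ leaves node $i$, $-1$ if $e$ enters $i$, $0$ otherwise), and $b\in\mathbb{R}^n$ satisfies $b\perp\mathbf{1}$ (the all-ones vector). The unweighted Laplacian is $\mathcal{L}=AA^{\mathsf{T}}$. For $v\in\mathbb{R}^n$ and positive semidefinite $M$, $\|v\|_M=\sqrt{v^{\mathsf{T}}Mv}$ (a seminorm if $M$ is singular). Costs: each edge $e$ has a strictly convex, twice continuously differentiable cost $\Phi_e:\mathbb{R}\to\mathbb{R}$ with $\gamma\le\ddot\Phi_e\le\Gamma$, $0<\gamma\le\Gamma$, and $\left|\frac{1}{\ddot\Phi_e(x)}-\frac{1}{\ddot\Phi_e(\hat x)}\right|\le\delta|x-\hat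 x|$ for all $x,\hat x\in\mathbb{R}$. The primal problem is to minimize $\sum_e\Phi_e(x^{(e)})$ subject to $Ax=b$. Dual: for $\lambda\in\mathbb{R}^n$ and $e=(i,j)$ let $x^{(e)}(\lambda)=(\dot\Phi_e)^{-1}(\lambda^{(i)}-\lambda^{(j)})$, and $q(\lambda)=\lambda^{\mathsf{T}}(Ax(\lambda)-b)-\sum_e\Phi_e(x^{(e)}(\lambda))$. This is a convex function, to be minimized. Its gradient is $\nabla q(\lambda)=Ax(\lambda)-b$ and its Hessian is $H(\lambda)=A\,\mathrm{diag}\big(1/\ddot\Phi_e(x^{(e)}(\lambda))\big)A^{\mathsf{T}}$. It is a known fact from prior work that $H$ is Lipschitz with respect to the Laplacian norm with constant $B$: $\|H(\bar\lambda)-H(\lambda)\|_{\mathcal{L}}\le B\|\bar\lambda-\lambda\|_{\mathcal{L}}$, where the left side is the operator norm induced by $\|\cdot\|_{\mathcal{L}}$; consequently $\|\nabla q(\hat\lambda)-\nabla q(\lambda)-H(\lambda)(\hat\lambda-\lambda)\|_{\mathcal{L}}\le\frac{B}{2}\|\hat\lambda-\lambda\|_{\mathcal{L}}^2$. Approximate Newton direction: write $g_k=\nabla q(\lambda_k)$, $H_k=H(\lambda_k)$, $H_k^{\dagger}$ for the pseudoinverse, and $d_k$ for a solution of $H_kd_k=-g_k$. The direction $\tilde d_k=-Z_kg_k$ is the output of a distributed linear-system solver run with precision $\epsilon$, where $Z_k$ is the solver's linear operator. The solver's guarantees are: (i) $\|\tilde d_k-d_k\|_{H_k}\le\epsilon\|d_k\|_{H_k}$;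 (ii) $e^{-\epsilon^2}v^{\mathsf{T}}H_k^{\dagger}v\le v^{\mathsf{T}}Z_kv\le e^{\epsilon^2}v^{\mathsf{T}}H_k^{\dagger}v$ for all $v\perp\mathbf{1}$. *)

(* Defs.v *)
From HB Require Import structures.
From mathcomp Require Import all_boot all_order all_algebra.
From mathcomp Require Import all_classical all_reals all_analysis.

Set Implicit Arguments.
Unset Strict Implicit.
Unset Printing Implicit Defensive.

Import Order.TTheory GRing.Theory Num.Theory.
Import numFieldNormedType.Exports.

Local Open Scope classical_set_scope.
Local Open Scope ring_scope.

(* Eigenvalues counted with algebraic multiplicity, in nondecreasing order.
   The default [::] is only reached when char_poly M does not split over R,
   which cannot happen for a symmetric matrix. *)
Definition eigenvalues (R : realType) (n : nat) (M : 'M[R]_n) : seq R :=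
  xget [::] [set s : seq R |
    sorted <=%R s /\ char_poly M = \prod_(x <- s) ('X - x%:P)].

(* Numbered from 1: mu_eig 1 M is the smallest eigenvalue, mu_eig n M the
   largest one. *)
Definition mu_eig (R : realType) (n : nat) (i : nat) (M : 'M[R]_n) : R :=
  (eigenvalues M)`_i.-1.

Definition pinv_spec (R : realType) (n : nat) (M X : 'M[R]_n) : Prop :=
  [/\ M *m X *m M = M, X *m M *m X = X,
      (M *m X)^T = M *m X & (X *m M)^T = X *m M].

(* Moore-Penrose pseudoinverse; mathcomp's pinvmx only satisfies the first two
   Penrose equations in general. *)
Definition mp_pinv (R : realType) (n : nat) (M : 'M[R]_n) : 'M[R]_n :=
  xget 0 [set X | pinv_spec M X].

Definition qform (R : realType) (n : nat) (M : 'M[R]_n) (v : 'cV[R]_n) : R :=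
  (v^T *m M *m v) 0 0.

Definition seminorm (R : realType) (n : nat) (M : 'M[R]_n) (v : 'cV[R]_n) : R :=
  Num.sqrt (qform M v).

(* Operator norm of N induced by the seminorm of M. It is +oo when N is not
   bounded for that seminorm. *)
Definition op_seminorm (R : realType) (n : nat) (M N : 'M[R]_n) : \bar R :=
  ereal_sup [set (seminorm M (N *m v))%:E | v in [set v | seminorm M v <= 1]].

Definition ones (R : realType) (n : nat) : 'cV[R]_n := const_mx 1.

Definition orth (R : realType) (n : nat) (u v : 'cV[R]_n) : Prop :=
  (u^T *m v) 0 0 = 0.

Definition gradient (R : realType) (n : nat) (f : 'cV[R]_n -> R)
    (x : 'cV[R]_n) : 'cV[R]_n :=
  \col_i 'D_(delta_mx i 0) f x.

Definition hessian (R : realType) (n : nat) (f : 'cV[R]_n -> R)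
    (x : 'cV[R]_n) : 'M[R]_n :=
  \matrix_(i, j) 'D_(delta_mx j 0) (fun y => gradient f y i 0) x.

Definition strictly_convex (R : realType) (f : R -> R) : Prop :=
  forall x y t : R, x != y -> 0 < t < 1 ->
    f (t * x + (1 - t) * y) < t * f x + (1 - t) * f y.

Definition twice_cont_diff (R : realType) (f : R -> R) : Prop :=
  [/\ forall x, derivable f x 1, forall x, derivable (f^`())%classic x 1 &
      continuous (f^`(2))%classic].

(* A directed graph on the nodes 'I_n is given by its set of edges; antiparallel
   edges are allowed. *)
Definition uadj (n : nat) (E : {set 'I_n * 'I_n}) : rel 'I_n :=
  fun i j => ((i, j) \in E) || ((j, i) \in E).

Definition loopless (n : nat) (E : {set 'I_n * 'I_n}) : Prop :=
  forall i, (i, i) \notin E.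

Definition uconnected (n : nat) (E : {set 'I_n * 'I_n}) : Prop :=
  forall i j, connect (uadj E) i j.

Definition ubipartite (n : nat) (E : {set 'I_n * 'I_n}) : Prop :=
  exists c : 'I_n -> bool, forall i j, uadj E i j -> c i != c j.

Definition algebraic_connectivity (R : realType) (n : nat)
    (E : {set 'I_n * 'I_n}) : R :=
  mu_eig 2 (\matrix_(i < n, j < n)
    ((#|[set k | uadj E i k]| * (i == j))%:R - (uadj E i j)%:R) : 'M[R]_n).

Definition esrc (n : nat) (E : {set 'I_n * 'I_n}) (e : 'I_#|E|) : 'I_n :=
  (enum_val e).1.

Definition edst (n : nat) (E : {set 'I_n * 'I_n}) (e : 'I_#|E|) : 'I_n :=
  (enum_val e).2.

Definition incidence (R : realType) (n : nat) (E : {set 'I_n * 'I_n}) :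
    'M[R]_(n, #|E|) :=
  \matrix_(i, e) if esrc e == i then 1 else if edst e == i then -1 else 0.

Definition laplacian (R : realType) (n : nat) (E : {set 'I_n * 'I_n}) :
    'M[R]_n :=
  incidence R E *m (incidence R E)^T.

Definition cost_ok (R : realType) (gamma Gamma delta : R) (f : R -> R) : Prop :=
  [/\ strictly_convex f, twice_cont_diff f,
      forall x, gamma <= (f^`(2))%classic x <= Gamma &
      forall x y, `|((f^`(2))%classic x)^-1 - ((f^`(2))%classic y)^-1| <= delta * `|x - y|].

(* 'pinv_(fun=> 0) setT f' is the inverse function of f' (with default value 0
   outside the range of f'). *)
Definition primal_of_dual (R : realType) (n : nat) (E : {set 'I_n * 'I_n})
    (Phi : 'I_#|E| -> R -> R) (lam : 'cV[R]_n) : 'cV[R]_#|E| :=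
  \col_e 'pinv_(fun=> 0) [set: R] ((Phi e)^`())%classic
           (lam (esrc e) 0 - lam (edst e) 0).

Definition dual (R : realType) (n : nat) (E : {set 'I_n * 'I_n})
    (Phi : 'I_#|E| -> R -> R) (b lam : 'cV[R]_n) : R :=
  let x := primal_of_dual Phi lam in
  (lam^T *m (incidence R E *m x - b)) 0 0 - \sum_e Phi e (x e 0).

(* Main.v *)
(* The dual function q is a sum of conjugates of the costs composed with the
   potential differences, so its Hessian H = A W A^T satisfies
   L / Gamma <= H <= L / gamma and shares the kernel of L, spanned by the
   all-ones vector. With D = ||d||_H^2 = g^T H^+ g this gives
     gamma / mu_n^2 ||g||_L^2 <= D <= Gamma / mu_2^2 ||g||_L^2.
   - Strict decrease: q(l + v) - q(l) <= v^T g + ||v||_L^2 / (2 gamma) with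
     v = alpha dt, where dt^T g <= - e^(-eps^2) D by the spectral guarantee of
     the solver and ||dt||_L^2 <= Gamma (1 + eps)^2 D; the step size makes the
     quadratic term at most half of the linear one.
   - Other phases: g_(k+1) = (1 - alpha) g + alpha H (dt - d) + r, where the
     Lipschitz Hessian gives ||r||_L <= B / 2 ||alpha dt||_L^2. Hence
     ||g_(k+1)||_L <= xi^2 ||g||_L + zeta ||g||_L^2, and the two bounds follow by
     comparing ||g||_L with eta_0. *)
Require Import Defs.
From HB Require Import structures.
From mathcomp Require Import all_boot all_order all_algebra all_fingroup.
From mathcomp Require Import spectral complex.
From mathcomp Require Import all_classical all_reals all_analysis.
From mathcomp Require Import ring lra.

Set Implicit Arguments.
Unset Strict Implicit.
Unset Printing Implicit Defensive.

Import Order.TTheory GRing.Theory Num.Theory.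
Import numFieldNormedType.Exports.

Local Open Scope classical_set_scope.
Local Open Scope ring_scope.

(** * Spectral bounds for real symmetric matrices *)

(** Since [U P = 1], the matrix [X - U D P] factors as [U (X - D) P], and the determinants of [U]
    and [P] cancel. *)
Lemma char_poly_similar (R : comNzRingType) n (U D P : 'M[R]_n) :
  U *m P = 1%:M -> char_poly (U *m D *m P) = char_poly D.
Proof.
move=> UP1; rewrite /char_poly /char_poly_mx.
suff -> : 'X%:M - map_mx polyC (U *m D *m P) =
    map_mx polyC U *m ('X%:M - map_mx polyC D) *m map_mx polyC P.
  by rewrite !det_mulmx mulrAC -det_mulmx -map_mxM UP1 map_mx1 det1 mul1r.
rewrite mulmxBr mulmxBl -!map_mxM /= mul_mx_scalar -scalemxAl -map_mxM UP1.
by rewrite map_mx1 scalemx1.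
Qed.

Section RealSymmetric.
Local Open Scope sesquilinear_scope.
Local Open Scope complex_scope.

Variables (R : realType) (n : nat).
Local Notation toC := (real_complex R).
Implicit Types (M : 'M[R]_n) (v : 'cV[R]_n) (P : 'M[R[i]]_n).

(** A real symmetric matrix is Hermitian over the complex numbers, so its spectral diagonal is real;
    only the unitary matrix [P] stays complex. *)
Lemma real_spectral M : M^T = M ->
  exists P, exists D : 'rV[R]_n,
    P \is unitarymx /\ map_mx toC M = P^t* *m diag_mx (map_mx toC D) *m P.
Proof.
move=> symM; pose MC := map_mx toC M.
have realM : MC \is a mxOver Num.real.
  by apply/mxOverP => i j; rewrite mxE complex_real.
have hermM : MC \is hermsymmx.
  apply: realsym_hermsym realM; apply/is_hermitianmxP.
  by rewrite expr0 scale1r map_mx_id // map_trmx symM.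
exists (spectralmx MC), (map_mx (@complex.Re R) (spectral_diag MC)).
split; first exact: spectral_unitarymx.
have /hermitian_normalmx/orthomx_spectralP := hermM.
rewrite invmx_unitary ?spectral_unitarymx // => MCE.
rewrite [LHS]MCE; congr mulmx; congr mulmx; congr diag_mx.
apply/matrixP => i j; rewrite !mxE RRe_real //.
by have /mxOverP := hermitian_spectral_diag_real hermM; apply.
Qed.

(** The chosen sequence and the entries of [D] both factor the characteristic polynomial into linear
    terms, so they agree up to a permutation. *)
Lemma eigenvalues_spectral M P (D : 'rV[R]_n) :
    P \is unitarymx -> map_mx toC M = P^t* *m diag_mx (map_mx toC D) *m P ->
  [/\ size (eigenvalues M) = n, sorted <=%R (eigenvalues M) &
  exists p : {perm 'I_n}, forall i, D 0 (p i) = (eigenvalues M)`_i].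
Proof.
move=> Pu MD; set s := eigenvalues M.
have charM : char_poly M = \prod_(x <- [seq D 0 i | i <- enum 'I_n]) ('X - x%:P).
  apply: (@map_poly_inj _ _ toC); rewrite map_char_poly MD char_poly_similar.
    rewrite char_poly_trig ?diag_mx_is_trig // rmorph_prod big_map big_enum /=.
    by apply: eq_bigr => i _; rewrite !mxE eqxx mulr1n rmorphB /= map_polyX map_polyC.
  by rewrite -invmx_unitary // mulVmx // unitarymx_unit.
have [ss sP] : sorted <=%R s /\ char_poly M = \prod_(x <- s) ('X - x%:P).
  apply: (@xgetPex _ [::] [set s : seq R |
    sorted <=%R s /\ char_poly M = \prod_(x <- s) ('X - x%:P)]).
  (* Sorting the diagonal shows that the choice is not the default [[::]]. *)
  exists (sort <=%R ([seq D 0 i | i <- enum 'I_n])); split; first exact: sort_le_sorted.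
  by rewrite charM; apply: perm_big; rewrite perm_sym perm_sort.
have : perm_eq s [tuple D 0 i | i < n].
  by apply: prod_XsubC_eq; rewrite -sP charM.
move=> /[dup] /perm_size; rewrite size_tuple => sz /tuple_permP[p sE].
split=> //; exists p => i.
by rewrite sE (nth_map i) ?size_enum_ord // nth_ord_enum tnth_mktuple.
Qed.

Lemma map_mx_entry m k (A : 'M[R]_(m, k)) i j :
  (A i j)%:C = (map_mx toC A) i j.
Proof. by rewrite mxE. Qed.

Lemma conj_map_mx m k (A : 'M[R]_(m, k)) : (map_mx toC A)^t* = map_mx toC A^T.
Proof. by apply/matrixP => i j; rewrite !mxE conj_Creal ?complex_real. Qed.

Lemma diag_qformC k (D : 'rV[R[i]]_k) (y : 'cV[R[i]]_k) :
  (y^t* *m diag_mx D *m y) 0 0 = \sum_i D 0 i * `|y i 0| ^+ 2.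
Proof.
rewrite mxE; apply: eq_bigr => i _.
by rewrite mul_mx_diag !mxE normCKC mulrCA mulrA.
Qed.

Lemma qform_spectral M P (D : 'rV[R]_n) v :
    map_mx toC M = P^t* *m diag_mx (map_mx toC D) *m P ->
  (qform M v)%:C =
    \sum_i (D 0 i)%:C * `|(P *m map_mx toC v) i 0| ^+ 2.
Proof.
move=> MD; rewrite /qform map_mx_entry !map_mxM MD -conj_map_mx.
under eq_bigr do rewrite map_mx_entry.
by rewrite -diag_qformC trmx_mul map_mxM !mulmxA.
Qed.

Lemma sqnorm_unitary P v : P \is unitarymx ->
  ((v^T *m v) 0 0)%:C = \sum_i `|(P *m map_mx toC v) i 0| ^+ 2.
Proof.
move=> Pu; have PP : P^t* *m P = 1%:M.
  by rewrite -invmx_unitary // mulVmx // unitarymx_unit.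
have := @qform_spectral 1%:M P (const_mx 1) v.
rewrite /qform mulmx1 => -> //.
  by apply: eq_bigr => i _; rewrite mxE mul1r.
by rewrite map_mx1 map_const_mx rmorph1 diag_const_mx mulmx1 PP.
Qed.

(** As [M] and [D] are real, [P M = D P] splits into real and imaginary parts. This turns complex
    eigenvectors into real ones, to which hypotheses on real vectors apply. *)
Lemma spectral_rows M P (D : 'rV[R]_n) :
    P \is unitarymx -> map_mx toC M = P^t* *m diag_mx (map_mx toC D) *m P ->
  map_mx (@complex.Re R) P *m M = diag_mx D *m map_mx (@complex.Re R) P /\
  map_mx (@complex.Im R) P *m M = diag_mx D *m map_mx (@complex.Im R) P.
Proof.
move=> /unitarymxP PP MD.
have PM : P *m map_mx toC M = diag_mx (map_mx toC D) *m P.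
  by rewrite MD !mulmxA PP mul1mx.
have ReM (x : R[i]) (a : R) : complex.Re (x * a%:C) = complex.Re x * a.
  by case: x => b c /=; rewrite mulr0 subr0.
have ImM (x : R[i]) (a : R) : complex.Im (x * a%:C) = complex.Im x * a.
  by case: x => b c /=; rewrite mulr0 add0r.
have ReD : {morph @complex.Re R : x y / x + y} by case=> a b [].
have ImD : {morph @complex.Im R : x y / x + y} by case=> a b [].
by split; apply/matrixP => i k; move/matrixP/(_ i k): PM;
  rewrite !mul_diag_mx !mxE;
  [move/(congr1 (@complex.Re R))|move/(congr1 (@complex.Im R))];
  rewrite [_ * P i k]mulrC ?ReM ?ImM ?(big_morph _ ReD (erefl _))
    ?(big_morph _ ImD (erefl _)) mulrC => <-; apply: eq_bigr => j _;
  rewrite !mxE ?ReM ?ImM.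
Qed.

Lemma sqnorm_sum k (v : 'cV[R]_k) : (v^T *m v) 0 0 = \sum_i v i 0 ^+ 2.
Proof. by rewrite mxE; apply: eq_bigr => i _; rewrite mxE expr2. Qed.

Lemma sqnorm_ge0 k (v : 'cV[R]_k) : 0 <= (v^T *m v) 0 0.
Proof. by rewrite sqnorm_sum sumr_ge0 // => i _; rewrite sqr_ge0. Qed.

Lemma sqnorm_eq0 k (v : 'cV[R]_k) : (v^T *m v) 0 0 = 0 -> v = 0.
Proof.
rewrite sqnorm_sum => /eqP; rewrite psumr_eq0 => [/allP v0|i _]; last exact: sqr_ge0.
apply/colP => i; rewrite mxE; apply/eqP; rewrite -sqrf_eq0.
by apply: (implyP (v0 i _)) => //; rewrite mem_index_enum.
Qed.

(** In the coordinates [P v] the form is a sum of squared moduli weighted by the eigenvalues. The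
    eigenvalue 0 is simple, with eigenvector [z], so a vector orthogonal to [z] has no component on
    it and only meets eigenvalues from the second one on. *)
Lemma rayleigh_spectral_gap M (z : 'cV[R]_n) :
    (1 < n)%N -> M^T = M -> (forall v, 0 <= qform M v) ->
    z != 0 -> M *m z = 0 ->
    (forall v, M *m v = 0 -> exists c, v = c *: z) ->
  [/\ 0 < mu_eig 2 M, mu_eig 2 M <= mu_eig n M,
      forall v, qform M v <= mu_eig n M * (v^T *m v) 0 0 &
      forall v, orth v z -> mu_eig 2 M * (v^T *m v) 0 0 <= qform M v].
Proof.
move=> n1 symM psdM z0 Mz kerM.
have [P [D [Pu MD]]] := real_spectral symM.
have [sz ss [p Dp]] := eigenvalues_spectral Pu MD.
have [PRe PIm] := spectral_rows Pu MD.
have /unitarymxP PP := Pu.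
have n0 : (0 < n)%N := ltnW n1.
(* Positions 0 and 1 of the sorted sequence; [mu_eig 2] reads position 1 and [mu_eig n] position
   [n.-1]. *)
pose o0 := Ordinal n0; pose o1 := Ordinal n1.
have Ppart i k : P i k = (complex.Re (P i k))%:C + 'i%C * (complex.Im (P i k))%:C.
  exact: complexE.
have eigM (Q : 'M[R]_n) i : Q *m M = diag_mx D *m Q ->
    M *m (row i Q)^T = D 0 i *: (row i Q)^T.
  move=> QM; rewrite -{1}symM -trmx_mul -row_mul QM mul_diag_mx.
  by apply/colP => k; rewrite !mxE.
(* A row of a unitary matrix is nonzero, so its real or its imaginary part is a nonzero real
   eigenvector on which the form can be evaluated. *)
have Dge0 i : 0 <= D 0 i.
  have qx (Q : 'M[R]_n) : Q *m M = diag_mx D *m Q -> row i Q != 0 -> 0 <= D 0 i.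
    move=> QM0 Q0; have QM := eigM _ i QM0; have := psdM (row i Q)^T.
    rewrite /qform -mulmxA QM -scalemxAr mxE pmulr_lge0 // lt_neqAle sqnorm_ge0.
    rewrite andbT eq_sym; apply: contra Q0 => /eqP/sqnorm_eq0/(congr1 trmx).
    by rewrite trmxK trmx0 => ->.
  have [re0|] := eqVneq (row i (map_mx (@complex.Re R) P)) 0; last exact: qx.
  have [im0|] := eqVneq (row i (map_mx (@complex.Im R) P)) 0; last exact: qx.
  have Pi0 k : P i k = 0.
    move/rowP/(_ k): re0; move/rowP/(_ k): im0; rewrite !mxE => im0 re0.
    by rewrite (Ppart i k) re0 im0 !rmorph0 mulr0 addr0.
  have /eqP := oner_neq0 R[i]; case.
  have /matrixP/(_ i i) := PP; rewrite mxE [RHS]mxE eqxx => PPii.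
  by rewrite -[LHS]/(true%:R) -PPii big1 // => k _; rewrite Pi0 mul0r.
have Dkey : forall i, D 0 i = 0 -> exists a : R[i], forall k, P i k = a * (z k 0)%:C.
  move=> i Di0; have row0 (Q : 'M[R]_n) : Q *m M = diag_mx D *m Q ->
      exists c, forall k, Q i k = c * z k 0.
    move=> QM; have := eigM _ i QM; rewrite Di0 scale0r => /kerM [c Ec]; exists c => k.
    by move/colP/(_ k): Ec; rewrite !mxE.
  have [c Ec] := row0 _ PRe; have [c' Ec'] := row0 _ PIm.
  exists (c%:C + 'i%C * c'%:C) => k.
  move: (Ec k) (Ec' k); rewrite !mxE => Rk Ik; rewrite Ppart Rk Ik.
  by rewrite !rmorphM /= mulrDl mulrA.
have mu2E : mu_eig 2 M = D 0 (p o1) by rewrite Dp.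
(* Two zero eigenvalues would give two orthonormal rows of P, both multiples
   of z. *)
have mu2_gt0 : 0 < mu_eig 2 M.
  rewrite mu2E lt_neqAle Dge0 andbT eq_sym; apply/eqP => D1.
  have D0 : D 0 (p o0) = 0.
    apply/eqP; rewrite eq_le Dge0 -{1}D1 !Dp andbT.
    by apply: (le_sorted_leq_nth 0 ss); rewrite ?inE ?sz.
  have [a Ea] := Dkey _ D0; have [b Eb] := Dkey _ D1.
  pose zz : R[i] := \sum_k (z k 0)%:C * ((z k 0)%:C)^*%R.
  have PPij i j a' b' : (forall k, P i k = a' * (z k 0)%:C) ->
      (forall k, P j k = b' * (z k 0)%:C) ->
      (i == j)%:R = a' * b'^*%R * zz.
    move=> Ei Ej; move/matrixP/(_ i j): PP; rewrite !mxE => <-.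
    rewrite mulr_sumr; apply: eq_bigr => k _.
    by rewrite !mxE Ei Ej rmorphM /= mulrACA.
  (* The off-diagonal product is 0, so one factor vanishes; that factor also enters the squared norm
     of one of the two rows, which is 1. *)
  have := PPij _ _ _ _ Ea Eb; rewrite (inj_eq perm_inj) /= => /esym/eqP.
  rewrite !mulf_eq0 => /orP[/orP[]/eqP E0|/eqP E0].
  - have := PPij _ _ _ _ Ea Ea; rewrite eqxx => /eqP.
    by rewrite E0 !mul0r oner_eq0.
  - have := PPij _ _ _ _ Eb Eb; rewrite eqxx => /eqP.
    by rewrite E0 mulr0 mul0r oner_eq0.
  - have := PPij _ _ _ _ Eb Eb; rewrite eqxx => /eqP.
    by rewrite E0 mulr0 oner_eq0.
have Dle i : D 0 i <= mu_eig n M.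
  rewrite -(permKV p i) Dp; apply: (le_sorted_leq_nth 0 ss); rewrite ?inE ?sz //.
    by rewrite prednK.
  by rewrite -ltnS prednK.
have Dgt i : i != p o0 -> mu_eig 2 M <= D 0 i.
  move=> ip; rewrite -(permKV p i) Dp; apply: (le_sorted_leq_nth 0 ss); rewrite ?inE ?sz //.
  rewrite lt0n; apply: contra ip => /eqP i0.
  by apply/eqP; rewrite -(permKV p i); congr (p _); apply/val_inj.
split=> //; first by rewrite mu2E.
  move=> v; rewrite -lecR rmorphM /= (qform_spectral _ MD) (sqnorm_unitary _ Pu).
  rewrite mulr_sumr; apply: ler_sum => i _; apply: ler_wpM2r; first exact: exprn_ge0.
  by rewrite lecR.
move=> v vz; rewrite -lecR rmorphM /= (qform_spectral _ MD) (sqnorm_unitary _ Pu).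
(* Applying [P M = D P] to [z] kills every coordinate of [P z] with a nonzero eigenvalue. *)
have Pz i : i != p o0 -> (P *m map_mx toC z) i 0 = 0.
  move=> ip; have Di0 : (D 0 i)%:C != 0.
    by rewrite fmorph_eq0 gt_eqF // (lt_le_trans mu2_gt0) // Dgt.
  apply: (mulfI Di0); rewrite mulr0.
  have : P *m map_mx toC M *m map_mx toC z = 0.
    by rewrite -mulmxA -map_mxM Mz map_mx0 mulmx0.
  rewrite MD !mulmxA PP mul1mx -mulmxA => /matrixP/(_ i 0).
  by rewrite mul_diag_mx !mxE.
(* [P] preserves the inner product, and [P z] lives on the single coordinate [p o0], so
   orthogonality of [v] and [z] reduces to that coordinate. *)
have Pv0 : (P *m map_mx toC v) (p o0) 0 = 0.
  have Pz0 : (P *m map_mx toC z) (p o0) 0 != 0.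
    apply: contra z0 => /eqP Pz0; apply/eqP/sqnorm_eq0/(@complexI R).
    rewrite (sqnorm_unitary _ Pu) rmorph0 big1 // => i _.
    have [->|/Pz ->] := eqVneq i (p o0); first by rewrite Pz0 normr0 expr0n.
    by rewrite normr0 expr0n.
  have : ((P *m map_mx toC z)^t* *m (P *m map_mx toC v)) 0 0 = 0.
    rewrite trmx_mul map_mxM !mulmxA -[_ *m P^t* *m P]mulmxA.
    rewrite -invmx_unitary // mulVmx ?unitarymx_unit // mulmx1 conj_map_mx.
    rewrite -map_mxM mxE -[z^T *m v]trmxK trmx_mul trmxK mxE.
    by move: vz; rewrite /orth => ->; rewrite rmorph0.
  rewrite mxE (bigD1 (p o0)) //= big1 => [|i /Pz Pzi].
    rewrite addr0 !mxE => /eqP; rewrite mulf_eq0 conjC_eq0 => /orP[/eqP E0|/eqP ->//].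
    by move: Pz0; rewrite mxE E0 eqxx.
  by rewrite [_^t* _ _]mxE [_^T _ _]mxE Pzi conjC0 mul0r.
rewrite mulr_sumr; apply: ler_sum => i _.
have [->|ip] := eqVneq i (p o0); first by rewrite Pv0 normr0 expr0n !mulr0.
by apply: ler_wpM2r; [exact: exprn_ge0|rewrite lecR Dgt].
Qed.
End RealSymmetric.

(** * Seminorms and pseudoinverses *)

Definition bform (R : realType) (n : nat) (M : 'M[R]_n) (u v : 'cV[R]_n) : R :=
  (u^T *m M *m v) 0 0.

Section Seminorm.
Variables (R : realType) (n : nat) (M : 'M[R]_n).
Implicit Types (u v : 'cV[R]_n) (a : R).

Lemma bformDl u u' v : bform M (u + u') v = bform M u v + bform M u' v.
Proof. by rewrite /bform linearD /= !mulmxDl mxE. Qed.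

Lemma bformDr u v v' : bform M u (v + v') = bform M u v + bform M u v'.
Proof. by rewrite /bform mulmxDr mxE. Qed.

Lemma bformZl a u v : bform M (a *: u) v = a * bform M u v.
Proof. by rewrite /bform linearZ /= -!scalemxAl mxE. Qed.

Lemma bformZr a u v : bform M u (a *: v) = a * bform M u v.
Proof. by rewrite /bform -scalemxAr mxE. Qed.

Lemma bformC u v : M^T = M -> bform M u v = bform M v u.
Proof.
move=> symM; rewrite /bform -[u^T *m M *m v]trmxK mxE.
by rewrite !trmx_mul trmxK symM mulmxA.
Qed.

Lemma qformZ a v : qform M (a *: v) = a ^+ 2 * qform M v.
Proof. by rewrite -[LHS]/(bform M _ _) bformZl bformZr mulrA. Qed.

Lemma qformN v : qform M (- v) = qform M v.
Proof. by rewrite -scaleN1r qformZ sqrrN expr1n mul1r. Qed.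

Lemma seminormZ a v : seminorm M (a *: v) = `|a| * seminorm M v.
Proof. by rewrite /seminorm qformZ sqrtrM ?sqr_ge0 // sqrtr_sqr. Qed.

Lemma seminorm_ge0 v : 0 <= seminorm M v.
Proof. exact: sqrtr_ge0. Qed.

Hypothesis symM : M^T = M.
Hypothesis psdM : forall v, 0 <= qform M v.

Lemma sqr_seminorm v : seminorm M v ^+ 2 = qform M v.
Proof. by rewrite sqr_sqrtr. Qed.

Lemma qformD u v : qform M (u + v) = qform M u + 2 * bform M u v + qform M v.
Proof.
rewrite -![qform _ _]/(bform M _ _) bformDl !bformDr (bformC v) //.
by rewrite mulr_natl mulr2n !addrA.
Qed.

(** The polynomial [a |-> qform M (u + a *: v)] is nonnegative. The form may be degenerate: if
    [qform M v = 0], the polynomial is affine, which forces [bform M u v = 0]. *)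
Lemma bform_Cauchy_Schwarz u v : bform M u v ^+ 2 <= qform M u * qform M v.
Proof.
have pos a : 0 <= qform M u + 2 * a * bform M u v + a ^+ 2 * qform M v.
  by have := psdM (u + a *: v); rewrite qformD bformZr qformZ mulrA.
have [v0|v0] := eqVneq (qform M v) 0; last first.
  have qv : 0 < qform M v by rewrite lt_neqAle eq_sym v0 psdM.
  have := pos (- (bform M u v / qform M v)).
  rewrite -(ler_pM2r qv) mul0r => h; rewrite -subr_ge0; apply: le_trans h _.
  by rewrite le_eqVlt; apply/orP; left; apply/eqP; field.
rewrite v0 mulr0 le_eqVlt; apply/orP; left; rewrite sqrf_eq0; apply/negP => b0.
(* At this point the affine function would take the value -1. *)
have := pos (- (qform M u + 1) / (2 * bform M u v)).
rewrite v0 mulr0 addr0.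
have -> : 2 * (- (qform M u + 1) / (2 * bform M u v)) * bform M u v =
   - (qform M u + 1) by field; apply/negP.
by lra.
Qed.

Lemma bform_le_seminorm u v : bform M u v <= seminorm M u * seminorm M v.
Proof.
rewrite (le_trans (ler_norm _)) // -sqrtr_sqr -sqrtrM //.
by rewrite ler_wsqrtr // bform_Cauchy_Schwarz.
Qed.

Lemma seminormD u v : seminorm M (u + v) <= seminorm M u + seminorm M v.
Proof.
rewrite -(ler_pXn2r (n := 2)) ?nnegrE ?addr_ge0 ?seminorm_ge0 //.
rewrite sqrrD !sqr_seminorm qformD mulr_natl.
by rewrite lerD2r lerD2l lerMn2r bform_le_seminorm.
Qed.

(** With [w = M v], the squared norm [s] of [w] equals [bform M w v]. Cauchy-Schwarz gives
    [s^2 <= c s qform M v], and [s] is divided out. *)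
Lemma sqnorm_mulmx_le c v : (forall u, qform M u <= c * (u^T *m u) 0 0) ->
  ((M *m v)^T *m (M *m v)) 0 0 <= c * qform M v.
Proof.
move=> Mc; set w := M *m v; set s := (w^T *m w) 0 0.
have sE : s = bform M w v by rewrite /s /bform -mulmxA.
have [s0|s0] := leP s 0.
  have -> : s = 0 by apply/eqP; rewrite eq_le s0 sqnorm_ge0.
  have [->|v0] := eqVneq v 0; first by rewrite /qform mulmx0 mxE mulr0.
  have vv : 0 < (v^T *m v) 0 0.
    rewrite lt_neqAle sqnorm_ge0 andbT eq_sym.
    by apply: contra v0 => /eqP/sqnorm_eq0 ->.
  by rewrite mulr_ge0 // -(pmulr_lge0 _ vv) (le_trans (psdM v)).
have := bform_Cauchy_Schwarz w v; rewrite -sE => CS.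
rewrite -(ler_pM2l s0) -expr2 (le_trans CS) // mulrCA mulrA.
by rewrite ler_wpM2r // Mc.
Qed.

End Seminorm.

(** Homogeneity reduces the bound to the unit ball. A vector of seminorm 0 cannot be normalized;
    there the bound [c * a] holds for every [a > 0]. *)
Lemma op_seminorm_le (R : realType) n (M N : 'M[R]_n) (c : R) :
    M^T = M -> (forall v, 0 <= qform M v) ->
    (op_seminorm M N <= c%:E)%E ->
  forall v, seminorm M (N *m v) <= c * seminorm M v.
Proof.
move=> symM psdM Nc v.
have bnd u : seminorm M u <= 1 -> seminorm M (N *m u) <= c.
  move=> u1; rewrite -lee_fin; apply: le_trans Nc; apply: ereal_sup_ubound.
  by exists u.
have c0 : 0 <= c.
  have := bnd 0; rewrite mulmx0 /seminorm /qform mulmx0 mxE sqrtr0 ler01.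
  exact.
have scaled a : 0 < a -> seminorm M v <= a -> seminorm M (N *m v) <= c * a.
  move=> a0 va; have := bnd (a^-1 *: v).
  rewrite -scalemxAr !seminormZ gtr0_norm ?invr_gt0 //.
  by rewrite !ler_pdivrMl // mulr1 [a * c]mulrC; apply.
apply/ler_addgt0Pr => e e0.
have [v0|v0] := eqVneq (seminorm M v) 0; last first.
  rewrite (le_trans (scaled _ _ (lexx _))) ?lerDl ?ltW //.
  by rewrite lt_neqAle eq_sym v0 seminorm_ge0.
rewrite v0 mulr0 add0r.
(* The added 1 keeps the denominator positive when [c = 0]. *)
have a0 : 0 < e / (c + 1) by rewrite divr_gt0 // ltr_wpDl.
apply: le_trans (scaled _ a0 _) _; first by rewrite v0 ltW.
have c1 : 0 < c + 1 by rewrite ltr_wpDl.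
by rewrite mulrCA ler_piMr ?ltW // ltr_pdivrMr // mul1r ltrDl.
Qed.

Section Pseudoinverse.
Variables (R : realType) (n : nat) (M : 'M[R]_n) (z : 'cV[R]_n).
Hypotheses (symM : M^T = M) (z_neq0 : z != 0) (Mz : M *m z = 0).
Hypothesis kerM : forall v, M *m v = 0 -> exists c, v = c *: z.

(* M plus the orthogonal projection J on its kernel is invertible, and
   subtracting J from the inverse gives the pseudoinverse. *)
Lemma mp_pinv_spec : pinv_spec M (mp_pinv M).
Proof.
apply: (@xgetPex _ 0 [set X | pinv_spec M X]).
pose s := (z^T *m z) 0 0; pose J := s^-1 *: (z *m z^T).
have s0 : s != 0.
  by apply: contra z_neq0 => /eqP/sqnorm_eq0 ->.
have MJ : M *m J = 0 by rewrite /J -scalemxAr mulmxA Mz mul0mx scaler0.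
have symJ : J^T = J by rewrite /J linearZ /= trmx_mul trmxK.
have JM : J *m M = 0 by rewrite -symM -symJ -trmx_mul MJ trmx0.
have Jz : J *m z = z.
  rewrite /J -scalemxAl -mulmxA [z^T *m z]mx11_scalar -/s mul_mx_scalar.
  by rewrite scalerA mulVf // scale1r.
have JJ : J *m J = J by rewrite {2}/J -scalemxAr mulmxA Jz.
pose K := M + J.
have symK : K^T = K by rewrite /K linearD /= symM symJ.
have JK : J *m K = J by rewrite mulmxDr JM JJ add0r.
have Kunit : K \in unitmx.
  (* A null vector of [K] is killed by [J], because [J K = J], and then by [M]. It is thus a
     multiple of [z], which [J] fixes, so it is zero. *)
  rewrite -row_free_unit -kermx_eq0; apply/eqP/row_matrixP => i.
  rewrite row0; set u := row i _.
  have uK : u *m K = 0 by apply/sub_kermxP; rewrite row_sub.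
  have Kv : K *m u^T = 0 by rewrite -symK -trmx_mul uK trmx0.
  have Jv : J *m u^T = 0 by rewrite -JK -mulmxA Kv mulmx0.
  have /kerM[c uE] : M *m u^T = 0 by move: Kv; rewrite mulmxDl Jv addr0.
  by rewrite -[u]trmxK uE -Jz scalemxAr -uE Jv trmx0.
have KJ : K *m J = J by rewrite -symK -{1}symJ -trmx_mul JK symJ.
have KVJ : invmx K *m J = J by rewrite -{1}KJ mulKmx.
have JKV : J *m invmx K = J by rewrite -{1}JK mulmxK.
have ME : M = K - J by rewrite addrK.
pose X := invmx K - J.
have MX : M *m X = 1%:M - J.
  by rewrite ME /X mulmxBr !mulmxBl mulmxV // KJ JKV JJ subrr subr0.
have XM : X *m M = 1%:M - J.
  by rewrite ME /X mulmxBr !mulmxBl mulVmx // JK KVJ JJ subrr subr0.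
exists X; split.
- by rewrite MX mulmxBl mul1mx JM subr0.
- by rewrite XM mulmxBl mul1mx /X mulmxBr JKV JJ subrr subr0.
- by rewrite MX linearB /= trmx1 symJ.
- by rewrite XM linearB /= trmx1 symJ.
Qed.

Lemma qform_mp_pinv d : qform (mp_pinv M) (M *m d) = qform M d.
Proof.
have [MXM _ _ _] := mp_pinv_spec.
rewrite /qform trmx_mul symM !mulmxA -[_ *m M *m mp_pinv M]mulmxA.
by rewrite -[_ *m (M *m _) *m M]mulmxA MXM.
Qed.

End Pseudoinverse.

(** * Conjugate of a strongly convex cost *)

Section Conjugate.
Variables (R : realType) (gamma Gamma delta : R) (f : R -> R).
Hypotheses (gamma_gt0 : 0 < gamma) (fok : cost_ok gamma Gamma delta f).

Local Notation df := (f^`())%classic.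
Local Notation ddf := (f^`(2))%classic.
Local Notation y := ('pinv_(fun=> 0) [set: R] df).

Lemma is_derive_cost (x : R) : is_derive x 1 f (df x).
Proof. by case: fok => _ [dd _ _] _ _; rewrite derive1E; exact: derivableP. Qed.

Lemma is_derive_derive1_cost (x : R) : is_derive x 1 df (ddf x).
Proof.
case: fok => _ [_ dd _] _ _; rewrite derive1nS derive1n1 derive1E.
exact: derivableP.
Qed.

Lemma cost_curvature x : gamma <= ddf x <= Gamma.
Proof. by case: fok. Qed.

Lemma ddf_gt0 x : 0 < ddf x.
Proof. by have /andP[+ _] := cost_curvature x; apply: lt_le_trans. Qed.

Lemma continuous_derive1_cost : continuous df.
Proof.
move=> x; apply/differentiable_continuous/derivable1_diffP.
by case: (is_derive_derive1_cost x).
Qed.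

(** Mean value theorem. This growth makes [df] a bijection of the line, so that [y] is a true
    inverse. *)
Lemma derive1_cost_growth (a b : R) : a <= b -> gamma * (b - a) <= df b - df a.
Proof.
move=> ab.
have [|c _ ->] :=
  MVT_segment ab (fun x : R => fun _ => is_derive_derive1_cost x).
  by apply: continuous_subspaceT => x; exact: continuous_derive1_cost.
by rewrite ler_wpM2r ?subr_ge0 //; case/andP: (cost_curvature c).
Qed.

Lemma derive1_cost_inj : injective df.
Proof.
move=> a b dab; apply/eqP; rewrite eq_le.
have half u v : df u = df v -> u <= v.
  move=> E; rewrite leNgt; apply/negP => vu.
  have := derive1_cost_growth (ltW vu).
  by rewrite E subrr pmulr_rle0 // subr_le0 leNgt vu.
by rewrite !half.
Qed.

Lemma derive1_costK : cancel df y.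
Proof. by move=> x; apply: pinvKV; rewrite ?inE // => ? ? _ _ /derive1_cost_inj. Qed.

Lemma derive1_cost_surj t : exists x, df x = t.
Proof.
(* By the growth bound, moving by [c] on either side of 0 changes [df] enough to reach [t]. *)
pose c := `|t - df 0| / gamma.
have c0 : 0 <= c by rewrite divr_ge0 // ltW.
have cc : - c <= c by rewrite (le_trans _ c0) // oppr_le0.
have gc : gamma * c = `|t - df 0| by rewrite mulrC divfK // gt_eqF.
have [||x _ <-] := @IVT R df (- c) c t cc; last by exists x.
  by apply: continuous_subspaceT => x; exact: continuous_derive1_cost.
have up := derive1_cost_growth c0.
have : gamma * (0 - - c) <= df 0 - df (- c).
  by apply: derive1_cost_growth; rewrite oppr_le0.
rewrite sub0r opprK gc; move: up; rewrite subr0 gc => up lo.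
have := ler_norm (t - df 0); have := lerNnormlW (lexx `|t - df 0|) => lt1 lt2.
rewrite ge_min le_max; apply/andP; split; apply/orP; [left|right]; lra.
Qed.

Lemma derive1_cost_pinvK : cancel y df.
Proof. by move=> t; have [x <-] := derive1_cost_surj t; rewrite derive1_costK. Qed.

Lemma is_derive_pinv (t : R) : is_derive t 1 y (ddf (y t))^-1.
Proof.
rewrite -{1}[t]derive1_cost_pinvK; apply: is_derive_inverse.
- by apply: (filterE (F := nbhs (y t))) => x; exact: derive1_costK.
- by apply: (filterE (F := nbhs (y t))) => x; exact: continuous_derive1_cost.
- exact: is_derive_derive1_cost.
- by rewrite gt_eqF // ddf_gt0.
Qed.

(** The function is the convex conjugate of [f]; the two terms containing the derivative of [y]
    cancel because [df (y t) = t]. *)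
Lemma is_derive_conjugate (t : R) : is_derive t 1 (fun s => s * y s - f (y s)) (y t).
Proof.
have dy := is_derive_pinv t.
have dfy : is_derive t 1 (f \o y) (df (y t) * (ddf (y t))^-1).
  by apply: is_derive1_comp; exact: is_derive_cost.
have -> : (fun s => s * y s - f (y s)) = (@idfun R * y) - (f \o y) by [].
apply: is_derive_eq; rewrite derive1_cost_pinvK /=.
by rewrite /GRing.scale /= mulr1 [X in X - _]addrC addrK.
Qed.

(** The derivative of [y] is at most [1 / gamma]. The product form is symmetric in [u] and [v], so
    the order of the arguments is immaterial. *)
Lemma pinv_Lipschitz (u v : R) : (y u - y v) * (u - v) <= gamma^-1 * (u - v) ^+ 2.
Proof.
wlog uv : u v / v <= u.
  move=> wl; have [/wl//|/ltW/wl] := leP v u.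
  by rewrite -[y v - y u]opprB -[v - u]opprB mulrNN sqrrN.
have [|c _ ->] := MVT_segment uv (fun x : R => fun _ => is_derive_pinv x).
  apply: continuous_subspaceT => x.
  apply/differentiable_continuous/derivable1_diffP.
  by case: (is_derive_pinv x).
rewrite -mulrA -expr2 ler_wpM2r ?sqr_ge0 // lef_pV2 ?posrE ?ddf_gt0 //.
by case/andP: (cost_curvature (y c)).
Qed.

End Conjugate.

(* Comparison with the primitive [c s^2 / 2] of the bound on the derivative. *)
Lemma le_half_of_derive_le (R : realType) (phi dphi : R -> R) (c : R) :
    (forall s : R, is_derive s 1 phi (dphi s)) ->
    (forall s, 0 <= s -> dphi s <= c * s) ->
  phi 1 - phi 0 <= c / 2.
Proof.
move=> dphiE dphi_le.
pose psi := phi - (c / 2) \*: (fun s => s ^+ 2).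
have dpsi (s : R) : is_derive s 1 psi (dphi s - c * s).
  have ds := dphiE s; rewrite /psi.
  apply: is_derive_eq; rewrite /GRing.scale /= !mulr1.
  by congr (_ - _); field.
have [|s] := MVT_segment (@ler01 R) (fun x : R => fun _ => dpsi x).
  apply: continuous_subspaceT => x.
  apply/differentiable_continuous/derivable1_diffP.
  by case: (dpsi x).
rewrite in_itv /= => /andP[s0 _]; rewrite subr0 mulr1 => psiE.
have psi1 : psi 1 = phi 1 - c / 2 * 1 ^+ 2 by [].
have psi0 : psi 0 = phi 0 - c / 2 * 0 ^+ 2 by [].
have := dphi_le s s0; rewrite -subr_le0 -psiE psi1 psi0 expr1n expr0n /=.
by lra.
Qed.

(** * Gradient and Hessian of the dual function *)

(** A directional derivative only sees the restriction to a line, so the gradient and Hessian come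
    from one-variable calculus. *)
Lemma is_derive_along_line (R : realType) n (f : 'cV[R]_n -> R)
    (a v : 'cV[R]_n) (l : R) :
  is_derive (0 : R) 1 (fun s => f (a + s *: v)) l -> is_derive a v f l.
Proof.
set g := fun s => _.
have E : (fun h : R => h^-1 *: ((f \o shift a) (h *: v) - f a)) =
         (fun h : R => h^-1 *: ((g \o shift 0) (h *: 1) - g 0)).
  apply/funext => h; rewrite /g /= scale0r !addr0 /GRing.scale /= mulr1.
  by rewrite [_ + a]addrC.
move=> [gd gE]; apply: DeriveDef; first by rewrite /derivable E.
by rewrite -gE /derive E.
Qed.

Lemma is_derive_sum_pt (R : realType) n (h : 'I_n -> R -> R) (dh : 'I_n -> R)
    (x : R) :
  (forall i, is_derive x 1 (h i) (dh i)) ->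
  is_derive x 1 (fun s => \sum_i h i s) (\sum_i dh i).
Proof.
move=> hd; have -> : (fun s => \sum_i h i s) = \sum_i h i.
  by apply/funext => s; rewrite fct_sumE.
exact: is_derive_sum.
Qed.

Lemma is_derive_comp_affine (R : realType) (f : R -> R) (a c l x : R) :
  is_derive (a + x * c) 1 f l -> is_derive x 1 (fun s => f (a + s * c)) (l * c).
Proof.
move=> fd; apply: (@is_derive1_comp _ f (fun s => a + s * c)).
have -> : (fun s => a + s * c) = cst a + c \*: id.
  by apply/funext => s; rewrite /= mulrC.
by apply: is_derive_eq; rewrite add0r /GRing.scale /= mulr1.
Qed.

Lemma bilinear_mulmxE (R : comNzRingType) m n (B : 'M[R]_(n, m)) (u : 'cV[R]_n)
    (x : 'cV[R]_m) :
  (u^T *m (B *m x)) 0 0 = \sum_e (B^T *m u) e 0 * x e 0.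
Proof.
rewrite mulmxA mxE; apply: eq_bigr => e _.
by rewrite -[B^T *m u]trmxK trmx_mul trmxK [in RHS]mxE.
Qed.

Section DualFunction.
Variables (R : realType) (n : nat) (E : {set 'I_n * 'I_n}).
Variables (Phi : 'I_#|E| -> R -> R) (b : 'cV[R]_n) (gamma Gamma delta : R).
Hypothesis loopE : loopless E.
Hypothesis gamma_gt0 : 0 < gamma.
Hypothesis costs : forall e, cost_ok gamma Gamma delta (Phi e).

Local Notation A := (incidence R E).
Local Notation L := (laplacian R E).
Local Notation q := (dual Phi b).
Local Notation y e := ('pinv_(fun=> 0) [set: R] ((Phi e)^`())%classic).
Implicit Types (l u v : 'cV[R]_n).

(** Without loops, the entries 1 and -1 of a column sit at distinct nodes. *)
Lemma tr_incidence_mulE l e : (A^T *m l) e 0 = l (esrc e) 0 - l (edst e) 0.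
Proof.
have sd : edst e != esrc e.
  apply: contra (loopE (esrc e)) => /eqP ds.
  by rewrite -{2}ds /esrc /edst -surjective_pairing enum_valP.
rewrite mxE (bigD1 (esrc e)) //= (bigD1 (edst e)) //= big1 => [|i /andP[si di]].
  by rewrite !mxE eqxx eq_sym (negbTE sd) eqxx mul1r mulN1r addr0.
by rewrite !mxE eq_sym (negbTE si) eq_sym (negbTE di) mul0r.
Qed.

(** The edge weights of the Hessian seen as a weighted Laplacian. *)
Definition conductance l : 'rV[R]_#|E| :=
  \row_e ((Phi e)^`(2)%classic (primal_of_dual Phi l e 0))^-1.

Definition dual_hessian l : 'M[R]_n := A *m diag_mx (conductance l) *m A^T.

Lemma primal_of_dualE l e : primal_of_dual Phi l e 0 = y e ((A^T *m l) e 0).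
Proof. by rewrite mxE tr_incidence_mulE. Qed.

(** Edge by edge, the dual is a sum of conjugates evaluated at potential differences, up to a linear
    term. *)
Lemma dualE l : q l =
  \sum_e ((A^T *m l) e 0 * y e ((A^T *m l) e 0) - Phi e (y e ((A^T *m l) e 0)))
  - (l^T *m b) 0 0.
Proof.
rewrite /dual mulmxBr mxE bilinear_mulmxE [X in _ + X - _]mxE.
rewrite sumrB [LHS]addrAC; congr (_ - _ - _).
  by apply: eq_bigr => e _; rewrite primal_of_dualE.
by apply: eq_bigr => e _; rewrite primal_of_dualE.
Qed.

Lemma is_derive_primal_of_dual l v e (s : R) :
  is_derive s 1 (fun s => primal_of_dual Phi (l + s *: v) e 0)
    (conductance (l + s *: v) 0 e * (A^T *m v) e 0).
Proof.
have lin r : (A^T *m (l + r *: v)) e 0 = (A^T *m l) e 0 + r * (A^T *m v) e 0.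
  by rewrite mulmxDr -scalemxAr !mxE.
have -> : (fun s => primal_of_dual Phi (l + s *: v) e 0) =
          (fun s => y e ((A^T *m l) e 0 + s * (A^T *m v) e 0)).
  by apply/funext => r; rewrite primal_of_dualE lin.
apply: is_derive_comp_affine; rewrite [conductance _ _ _]mxE primal_of_dualE lin.
exact: is_derive_pinv gamma_gt0 (costs e) _.
Qed.

Lemma is_derive_dual_line l v (s : R) :
  is_derive s 1 (fun s => q (l + s *: v))
    ((v^T *m (A *m primal_of_dual Phi (l + s *: v) - b)) 0 0).
Proof.
have lin e r : (A^T *m (l + r *: v)) e 0 = (A^T *m l) e 0 + r * (A^T *m v) e 0.
  by rewrite mulmxDr -scalemxAr !mxE.
pose F e t := t * y e t - Phi e (y e t).
have -> : (fun s => q (l + s *: v)) =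
    (fun s => \sum_e F e ((A^T *m l) e 0 + s * (A^T *m v) e 0)) -
    (fun s => (fun r => r) ((l^T *m b) 0 0 + s * (v^T *m b) 0 0)).
  apply/funext => r; rewrite dualE; congr (_ - _).
    by apply: eq_bigr => e _; rewrite lin.
  by rewrite linearD linearZ /= mulmxDl -scalemxAl !mxE.
have -> : (v^T *m (A *m primal_of_dual Phi (l + s *: v) - b)) 0 0 =
    \sum_e (primal_of_dual Phi (l + s *: v) e 0 * (A^T *m v) e 0)
    - 1 * (v^T *m b) 0 0.
  rewrite mul1r mulmxBr mxE [X in _ + X]mxE; congr (_ - _).
  by rewrite bilinear_mulmxE; apply: eq_bigr => e _; rewrite mulrC.
apply: is_deriveB; last by apply: is_derive_comp_affine; exact: is_derive_id.
apply: is_derive_sum_pt => e; apply: is_derive_comp_affine.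
rewrite primal_of_dualE lin.
exact: is_derive_conjugate gamma_gt0 (costs e) _.
Qed.

(** Coordinate vectors [u] yield the Hessian entries; a general [u] serves to test the linearization
    error of the gradient. *)
Lemma is_derive_residual_line u l v (s : R) :
  is_derive s 1 (fun s => (u^T *m (A *m primal_of_dual Phi (l + s *: v) - b)) 0 0)
    (bform (dual_hessian (l + s *: v)) u v).
Proof.
have -> : (fun s => (u^T *m (A *m primal_of_dual Phi (l + s *: v) - b)) 0 0) =
    (fun s => \sum_e (A^T *m u) e 0 *: primal_of_dual Phi (l + s *: v) e 0) -
    cst ((u^T *m b) 0 0).
  apply/funext => r; rewrite mulmxBr mxE [X in _ + X]mxE; congr (_ - _).
  by rewrite bilinear_mulmxE.
have -> : bform (dual_hessian (l + s *: v)) u v =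
  \sum_e (A^T *m u) e 0 *: (conductance (l + s *: v) 0 e * (A^T *m v) e 0) - 0.
  rewrite subr0 /bform /dual_hessian -!mulmxA bilinear_mulmxE.
  by apply: eq_bigr => e _; rewrite mul_diag_mx [X in _ * X]mxE.
apply: is_deriveB; apply: is_derive_sum_pt => e; apply: is_deriveZ.
exact: is_derive_primal_of_dual.
Qed.

Lemma gradient_dual l : gradient q l = A *m primal_of_dual Phi l - b.
Proof.
apply/colP => i; rewrite mxE.
have dq := is_derive_along_line (is_derive_dual_line l (delta_mx i 0) 0).
rewrite derive_val scale0r addr0 trmx_delta -rowE mxE.
by [].
Qed.

Lemma hessian_dual l : hessian q l = dual_hessian l.
Proof.
apply/matrixP => i j; rewrite mxE.
pose f x := ((delta_mx i 0 : 'cV[R]_n)^T *m (A *m primal_of_dual Phi x - b)) 0 0.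
have -> : (fun x => gradient q x i 0) = f.
  by apply/funext => x; rewrite gradient_dual /f trmx_delta -rowE [RHS]mxE.
have dq := @is_derive_along_line _ _ f _ _ _
  (is_derive_residual_line (delta_mx i 0) l (delta_mx j 0) 0).
rewrite derive_val scale0r addr0 /bform trmx_delta -rowE -colE.
by rewrite !mxE.
Qed.

End DualFunction.

Lemma entry_sub (R : pzRingType) m k (M N : 'M[R]_(m, k)) i j :
  M i j - N i j = (M - N) i j.
Proof. by rewrite !mxE. Qed.

(** * Comparison of Hessian and Laplacian, and estimates along segments *)

Section DualGeometry.
Variables (R : realType) (n : nat) (E : {set 'I_n * 'I_n}).
Variables (Phi : 'I_#|E| -> R -> R) (b : 'cV[R]_n) (gamma Gamma delta : R).
Hypothesis loopE : loopless E.

Local Notation A := (incidence R E).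
Local Notation L := (laplacian R E).
Local Notation q := (dual Phi b).
Implicit Types (l u v : 'cV[R]_n).

Lemma laplacian_sym : L^T = L.
Proof. by rewrite trmx_mul trmxK. Qed.

Lemma qform_laplacian v : qform L v = \sum_e (A^T *m v) e 0 ^+ 2.
Proof.
rewrite /qform /laplacian -!mulmxA bilinear_mulmxE.
by apply: eq_bigr => e _; rewrite expr2.
Qed.

Lemma laplacian_psd v : 0 <= qform L v.
Proof. by rewrite qform_laplacian sumr_ge0 // => e _; rewrite sqr_ge0. Qed.

Lemma tr_incidence_ones : A^T *m ones R n = 0.
Proof. by apply/colP => e; rewrite tr_incidence_mulE // !mxE subrr. Qed.

(** A potential with zero difference across each edge is constant along undirected paths, hence on
    the connected graph. *)
Lemma tr_incidence_kernel v : uconnected E -> A^T *m v = 0 ->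
  exists c, v = c *: ones R n.
Proof.
move=> conE Av0.
have adj i j : uadj E i j -> v i 0 = v j 0.
  have edge e1 e2 : (e1, e2) \in E -> v e1 0 = v e2 0.
    move=> eE; move/colP/(_ (enum_rank_in eE (e1, e2))): Av0.
    rewrite tr_incidence_mulE // /esrc /edst enum_rankK_in // mxE => /eqP.
    by rewrite subr_eq0 => /eqP.
  by case/orP => /edge.
have con i j : v i 0 = v j 0.
  case/connectP: (conE i j) => s + ->; elim: s i => //= k s IHs i /andP[ik /IHs <-].
  exact: adj.
case: (pickP 'I_n) => [i _|no]; last by exists 0; apply/colP => i; have := no i.
by exists (v i 0); apply/colP => j; rewrite !mxE mulr1.
Qed.

Lemma laplacian_ones : L *m ones R n = 0.
Proof. by rewrite -mulmxA tr_incidence_ones mulmx0. Qed.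

Lemma qform_laplacian_eq0 v : qform L v = 0 -> A^T *m v = 0.
Proof.
move=> Lv; apply: sqnorm_eq0.
by rewrite sqnorm_sum -qform_laplacian.
Qed.

Hypotheses (gamma_gt0 : 0 < gamma) (gamma_le : gamma <= Gamma).
Hypothesis costs : forall e, cost_ok gamma Gamma delta (Phi e).

Let Gamma_gt0 : 0 < Gamma. Proof. exact: lt_le_trans gamma_le. Qed.

Lemma conductance_bounds l e :
  Gamma^-1 <= conductance Phi l 0 e <= gamma^-1.
Proof.
rewrite mxE; case: (costs e) => _ _ /(_ (primal_of_dual Phi l e 0)) /andP[lo hi] _.
have dd0 := lt_le_trans gamma_gt0 lo.
by rewrite !lef_pV2 ?posrE ?lo ?hi.
Qed.

Lemma dual_hessian_sym l : (dual_hessian Phi l)^T = dual_hessian Phi l.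
Proof. by rewrite !trmx_mul trmxK tr_diag_mx mulmxA. Qed.

Lemma qform_dual_hessian l v :
  qform (dual_hessian Phi l) v =
  \sum_e conductance Phi l 0 e * (A^T *m v) e 0 ^+ 2.
Proof.
rewrite /qform /dual_hessian -!mulmxA bilinear_mulmxE.
by apply: eq_bigr => e _; rewrite mul_diag_mx [X in _ * X]mxE mulrCA expr2.
Qed.

Lemma dual_hessian_le l v : qform (dual_hessian Phi l) v <= gamma^-1 * qform L v.
Proof.
rewrite qform_dual_hessian qform_laplacian mulr_sumr; apply: ler_sum => e _.
by rewrite ler_wpM2r ?sqr_ge0 //; case/andP: (conductance_bounds l e).
Qed.

Lemma dual_hessian_ge l v : qform L v <= Gamma * qform (dual_hessian Phi l) v.
Proof.
rewrite -ler_pdivrMl // qform_dual_hessian qform_laplacian mulr_sumr.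
apply: ler_sum => e _.
by rewrite ler_wpM2r ?sqr_ge0 //; case/andP: (conductance_bounds l e).
Qed.

Lemma dual_hessian_psd l v : 0 <= qform (dual_hessian Phi l) v.
Proof.
rewrite -(pmulr_rge0 _ Gamma_gt0) (le_trans (laplacian_psd v)) //.
exact: dual_hessian_ge.
Qed.

Lemma dual_hessian_ones l : dual_hessian Phi l *m ones R n = 0.
Proof. by rewrite -mulmxA tr_incidence_ones mulmx0. Qed.

Lemma laplacian_kernel v : uconnected E -> L *m v = 0 ->
  exists c, v = c *: ones R n.
Proof.
move=> conE Lv; apply: tr_incidence_kernel => //; apply: qform_laplacian_eq0.
by rewrite /qform -mulmxA Lv mulmx0 mxE.
Qed.

Lemma dual_hessian_kernel l v : uconnected E -> dual_hessian Phi l *m v = 0 ->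
  exists c, v = c *: ones R n.
Proof.
move=> conE Hv; apply: tr_incidence_kernel => //; apply: qform_laplacian_eq0.
apply/eqP; rewrite eq_le laplacian_psd andbT (le_trans (dual_hessian_ge l v)) //.
by rewrite /qform -mulmxA Hv mulmx0 mxE mulr0.
Qed.

(** Descent lemma in the Laplacian seminorm: along the segment the slope of [q] exceeds its initial
    value by at most [s / gamma * qform L v], since each [y e] is [1 / gamma]-Lipschitz. *)
Lemma dual_le_quadratic l v :
  q (l + v) - q l <=
  (v^T *m gradient q l) 0 0 + gamma^-1 / 2 * qform L v.
Proof.
pose x := primal_of_dual Phi; pose G := A *m x l - b.
have -> : gradient q l = G by rewrite (gradient_dual _ loopE gamma_gt0 costs).
pose phi s := q (l + s *: v) - (fun s => 0 + s * (v^T *m G) 0 0) s.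
have phiE (s : R) : is_derive s 1 phi
    ((v^T *m (A *m x (l + s *: v) - b)) 0 0 - 1 * (v^T *m G) 0 0).
  apply: is_deriveB.
    exact: is_derive_dual_line loopE gamma_gt0 costs _ _ _.
  by apply: (@is_derive_comp_affine _ id); exact: is_derive_id.
have := le_half_of_derive_le phiE (c := gamma^-1 * qform L v).
rewrite /phi scale1r scale0r !addr0 !add0r mul1r mul0r subr0.
have E2 : gamma^-1 * qform L v / 2 = gamma^-1 / 2 * qform L v by rewrite mulrAC.
rewrite E2 => le_quad; rewrite -lerBlDl addrAC; apply: le_quad => s s0.
have -> : (v^T *m (A *m x (l + s *: v) - b)) 0 0 - (v^T *m G) 0 0 =
  \sum_e (A^T *m v) e 0 * (x (l + s *: v) e 0 - x l e 0).
  rewrite entry_sub -mulmxBr /G opprB addrA subrK -mulmxBr bilinear_mulmxE.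
  by apply: eq_bigr => e _; rewrite -entry_sub.
rewrite qform_laplacian mulr_sumr mulr_suml; apply: ler_sum => e _.
move: s0; rewrite le_eqVlt => /predU1P[<-|s0].
  by rewrite scale0r addr0 subrr !mulr0.
(* The factor [s > 0] turns [tv] into the argument increment [s * tv], as the Lipschitz bound in
   product form requires. *)
rewrite -(ler_pM2r s0) /x !primal_of_dualE //.
have -> : (A^T *m (l + s *: v)) e 0 = (A^T *m l) e 0 + s * (A^T *m v) e 0.
  by rewrite mulmxDr -scalemxAr !mxE.
set t := (A^T *m l) e 0; set tv := (A^T *m v) e 0.
have := pinv_Lipschitz gamma_gt0 (costs e) (t + s * tv) t.
rewrite [t + _ - t]addrC addKr.
set Y := _ - _ => YL.
rewrite (_ : tv * Y * s = Y * (s * tv)); last by ring.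
by rewrite (_ : gamma^-1 * _ * s * s = gamma^-1 * (s * tv) ^+ 2); last by ring.
Qed.

Lemma gradient_linearization (B : R) l v : 0 <= B ->
    (forall l l', seminorm L ((dual_hessian Phi l' - dual_hessian Phi l) *m v) <=
       B * seminorm L (l' - l) * seminorm L v) ->
  seminorm L (gradient q (l + v) - gradient q l - dual_hessian Phi l *m v) <=
  B / 2 * seminorm L v ^+ 2.
Proof.
move=> B0 HB; pose x := primal_of_dual Phi; pose H := dual_hessian Phi l.
rewrite !(gradient_dual _ loopE gamma_gt0 costs) -/x -/H.
set r := _ - _ - _.
(* The remainder is tested against w = L r, which turns the vector estimate
   into a one-dimensional one along the segment. *)
pose w := L *m r.
pose phi s := (w^T *m (A *m x (l + s *: v) - b)) 0 0 -
  (fun s => 0 + s * bform H w v) s.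
have phiE (s : R) : is_derive s 1 phi
    (bform (dual_hessian Phi (l + s *: v)) w v - 1 * bform H w v).
  apply: is_deriveB.
    exact: is_derive_residual_line loopE gamma_gt0 costs _ _ _ _.
  by apply: (@is_derive_comp_affine _ id); exact: is_derive_id.
(* The increment of [phi] is [seminorm L r ^+ 2], so dividing the resulting bound by [seminorm L r]
   gives the claim. *)
have := le_half_of_derive_le phiE (c := B * seminorm L r * seminorm L v ^+ 2).
have -> : phi 1 - phi 0 = seminorm L r ^+ 2.
  rewrite (sqr_seminorm laplacian_psd) /phi scale1r scale0r addr0 mul1r mul0r !add0r subr0.
  rewrite /bform -mulmxA !entry_sub -!mulmxBr addrAC -/r.
  by rewrite /w trmx_mul laplacian_sym.
move=> key; have [r0|r0] := eqVneq (seminorm L r) 0.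
  by rewrite r0 mulr_ge0 ?divr_ge0 ?sqr_ge0.
have rgt : 0 < seminorm L r by rewrite lt_neqAle eq_sym r0 seminorm_ge0.
rewrite -(ler_pM2l rgt) -expr2 (le_trans (key _)) //; last first.
  by rewrite le_eqVlt; apply/orP; left; apply/eqP; ring.
move=> s s0.
have -> : bform (dual_hessian Phi (l + s *: v)) w v - 1 * bform H w v =
    bform L r ((dual_hessian Phi (l + s *: v) - H) *m v).
  rewrite mul1r /bform entry_sub -mulmxBl -mulmxBr.
  by rewrite /w trmx_mul laplacian_sym !mulmxA.
apply: (le_trans (bform_le_seminorm laplacian_sym laplacian_psd _ _)).
have := HB l (l + s *: v).
rewrite (_ : l + s *: v - l = s *: v); last by rewrite [l + _]addrC addrK.
rewrite seminormZ ger0_norm // => h.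
apply: (le_trans (ler_wpM2l (seminorm_ge0 _ _) h)).
by rewrite le_eqVlt; apply/orP; left; apply/eqP; ring.
Qed.

End DualGeometry.

(** * One approximate Newton step *)

Lemma dotC (R : comNzRingType) n (u v : 'cV[R]_n) :
  (u^T *m v) 0 0 = (v^T *m u) 0 0.
Proof. by rewrite -[u^T *m v]trmxK trmx_mul trmxK mxE. Qed.

Section NewtonStep.
Variables (R : realType) (n : nat) (L H : 'M[R]_n) (z g d : 'cV[R]_n).
Variables (gamma Gamma mu nu : R).
Hypotheses (symL : L^T = L) (symH : H^T = H).
Hypotheses (psdL : forall v, 0 <= qform L v) (psdH : forall v, 0 <= qform H v).
Hypotheses (gamma_gt0 : 0 < gamma) (Gamma_gt0 : 0 < Gamma).
Hypotheses (mu_gt0 : 0 < mu) (mu_le : mu <= nu).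
Hypothesis H_le : forall v, qform H v <= gamma^-1 * qform L v.
Hypothesis H_ge : forall v, qform L v <= Gamma * qform H v.
Hypothesis L_le : forall v, qform L v <= nu * (v^T *m v) 0 0.
Hypothesis L_ge : forall v, orth v z -> mu * (v^T *m v) 0 0 <= qform L v.
Hypotheses (z_neq0 : z != 0) (Hz : H *m z = 0) (Hd : H *m d = - g).

Let nu_gt0 : 0 < nu. Proof. exact: lt_le_trans mu_le. Qed.

(** One factor [nu] bounds [L] by the Euclidean norm; the other comes from [H <= nu / gamma], which
    bounds the squared norm of [H e]. *)
Lemma qform_image_le e : qform L (H *m e) <= nu ^+ 2 / gamma * qform H e.
Proof.
have H_nu v : qform H v <= (nu / gamma) * (v^T *m v) 0 0.
  rewrite (le_trans (H_le v)) // [nu / _]mulrC -mulrA ler_wpM2l //.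
  by rewrite invr_ge0 ltW.
apply: le_trans (L_le _) _; rewrite expr2 -!mulrA ler_wpM2l ?(ltW nu_gt0) //.
by rewrite mulrA; apply: sqnorm_mulmx_le.
Qed.

Lemma newton_decrement_ge : gamma / nu ^+ 2 * qform L g <= qform H d.
Proof.
have := qform_image_le d; rewrite Hd qformN => gd.
rewrite mulrC -[gamma / _]invf_div ler_pdivrMr ?divr_gt0 ?exprn_gt0 //.
by rewrite mulrC.
Qed.

(** Up to sign the decrement is the inner product of [g] and [d]. Euclidean Cauchy-Schwarz applies,
    and on vectors orthogonal to [z] each Euclidean norm costs a factor [1 / mu]. *)
Lemma newton_decrement_le : qform H d <= Gamma / mu ^+ 2 * qform L g.
Proof.
have zz : (z^T *m z) 0 0 != 0 by apply: contra z_neq0 => /eqP/sqnorm_eq0 ->.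
(* A Newton direction is only determined modulo [z]; its projection makes the spectral gap
   available. *)
pose d' := d - ((z^T *m d) 0 0 / (z^T *m z) 0 0) *: z.
have Hd' : H *m d' = - g by rewrite mulmxBr -scalemxAr Hz scaler0 subr0.
have orth_d' : orth d' z.
  rewrite /orth dotC /d' mulmxBr -scalemxAr -entry_sub.
  by rewrite [X in _ - X]mxE divfK // subrr.
have orth_g : orth g z.
  rewrite /orth -[g]opprK -Hd linearN /= trmx_mul symH mulNmx -mulmxA Hz.
  by rewrite mulmx0 oppr0 mxE.
have HdE : qform H d = qform H d'.
  rewrite /d' -scaleNr qformD // qformZ bformZr {3}/qform /bform -!mulmxA Hz.
  have mx00 : (0 : 'M[R]_1) 0 0 = 0 by rewrite mxE.
  by rewrite !mulmx0 mx00 !mulr0 !addr0.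
rewrite HdE; set X := qform H d'.
have X0 : 0 <= X by exact: psdH.
have XE : X = - bform 1%:M g d'.
  by rewrite /X /qform -mulmxA Hd' mulmxN mxE /bform mulmx1 dotC.
have d'_le : (d'^T *m d') 0 0 <= Gamma / mu * X.
  rewrite mulrAC ler_pdivlMr // mulrC.
  exact: le_trans (L_ge orth_d') (H_ge _).
have g_le : (g^T *m g) 0 0 <= mu^-1 * qform L g by rewrite ler_pdivlMl // L_ge.
have CS : X ^+ 2 <= (g^T *m g) 0 0 * (d'^T *m d') 0 0.
  rewrite XE sqrrN.
  have := @bform_Cauchy_Schwarz R n 1%:M (trmx1 _ _) _ g d'.
  rewrite /qform !mulmx1; apply => v; rewrite mulmx1; exact: sqnorm_ge0.
have := X0; rewrite le_eqVlt => /predU1P[<-|X_gt0].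
  by rewrite mulr_ge0 ?divr_ge0 ?exprn_ge0 // ltW.
rewrite -(ler_pM2r X_gt0) -expr2 (le_trans CS) //.
apply: (le_trans (ler_pM (sqnorm_ge0 _) (sqnorm_ge0 _) g_le d'_le)).
by rewrite le_eqVlt; apply/orP; left; apply/eqP; field; rewrite gt_eqF.
Qed.

Lemma seminorm_residual_step eps alpha dt :
    0 <= alpha <= 1 ->
    seminorm H (dt - d) <= eps * seminorm H d -> 0 <= eps ->
  seminorm L (g + H *m (alpha *: dt)) <=
  (1 - alpha + alpha * eps * (nu / mu) * Num.sqrt (Gamma / gamma)) * seminorm L g.
Proof.
move=> /andP[a0 a1] solver e0.
(* An exact direction would shrink [g] by [1 - alpha]; the rest is solver error. *)
have -> : g + H *m (alpha *: dt) = (1 - alpha) *: g + alpha *: (H *m (dt - d)).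
  rewrite -scalemxAr mulmxBr Hd opprK scalerDr scalerBl scale1r.
  by rewrite addrCA addrC subrK.
apply: le_trans (seminormD symL psdL _ _) _.
rewrite !seminormZ !ger0_norm ?subr_ge0 //.
rewrite [X in _ <= X]mulrDl lerD2l -!mulrA ler_wpM2l //.
have nug : Num.sqrt (nu ^+ 2 / gamma) = nu / Num.sqrt gamma.
  by rewrite sqrtrM ?sqr_ge0 // sqrtr_sqr gtr0_norm // sqrtrV // ltW.
have Gmu : Num.sqrt (Gamma / mu ^+ 2) = Num.sqrt Gamma / mu.
  by rewrite sqrtrM ?ltW // sqrtrV ?sqr_ge0 // sqrtr_sqr gtr0_norm.
have He e : seminorm L (H *m e) <= nu / Num.sqrt gamma * seminorm H e.
  rewrite -nug /seminorm -sqrtrM; last by rewrite divr_ge0 ?sqr_ge0 // ltW.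
  by rewrite ler_wsqrtr // qform_image_le.
have dle : seminorm H d <= Num.sqrt Gamma / mu * seminorm L g.
  rewrite -Gmu /seminorm -sqrtrM; last by rewrite divr_ge0 ?sqr_ge0 // ltW.
  by rewrite ler_wsqrtr // newton_decrement_le.
have c0 : 0 <= nu / Num.sqrt gamma by rewrite divr_ge0 ?sqrtr_ge0 // ltW.
apply: le_trans (He _) _.
apply: le_trans (ler_wpM2l c0 (le_trans solver (ler_wpM2l e0 dle))) _.
rewrite le_eqVlt; apply/orP; left; apply/eqP.
rewrite sqrtrM ?ltW // sqrtrV ?ltW //; field.
by rewrite !gt_eqF ?sqrtr_gt0.
Qed.

Lemma qform_approx_direction_le eps dt :
    seminorm H (dt - d) <= eps * seminorm H d -> 0 <= eps ->
  qform L dt <= Gamma * (1 + eps) ^+ 2 * qform H d.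
Proof.
move=> solver e0; apply: le_trans (H_ge _) _.
rewrite -mulrA ler_wpM2l ?(ltW Gamma_gt0) //.
have dtle : seminorm H dt <= (1 + eps) * seminorm H d.
  rewrite -[dt](subrK d) (le_trans (seminormD symH psdH _ _)) //.
  by rewrite mulrDl mul1r addrC lerD2l.
rewrite -(sqr_seminorm psdH dt) -(sqr_seminorm psdH d) -exprMn ler_pXn2r //.
  exact: seminorm_ge0.
by rewrite nnegrE mulr_ge0 ?seminorm_ge0 // addr_ge0.
Qed.

End NewtonStep.

(** On at most one node a loopless graph has no edge, so a constant colouring is proper. *)
Lemma not_ubipartite_gt1 n (E : {set 'I_n * 'I_n}) :
  loopless E -> ~ ubipartite E -> (1 < n)%N.
Proof.
move=> loopE nb; rewrite ltnNge; apply/negP => n1; apply: nb.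
exists (fun=> true) => i j.
have <- : i = j.
  apply: ord_inj; have := leq_trans (ltn_ord i) n1.
  have := leq_trans (ltn_ord j) n1.
  by rewrite !ltnS !leqn0 => /eqP-> /eqP->.
by rewrite /uadj orbb (negbTE (loopE i)).
Qed.

(** * Consequences of the scalar recursion *)

Section ScalarPhases.
Variables (R : realFieldType) (xi zeta x y : R).
Hypotheses (xi_ge0 : 0 <= xi) (xi_lt1 : xi < 1) (zeta_gt0 : 0 < zeta).
Hypotheses (x_ge0 : 0 <= x) (y_le : y <= xi ^+ 2 * x + zeta * x ^+ 2).

Lemma quadratic_phase : xi * (1 - xi) / zeta <= x ->
  y <= ((1 - xi) / zeta)^-1 * x ^+ 2.
Proof.
have xi1 : 0 < 1 - xi by rewrite subr_gt0.
rewrite ler_pdivrMr // => lo; apply: (le_trans y_le).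
rewrite invf_div [X in _ <= X]mulrAC ler_pdivlMr //.
(* After clearing denominators, the goal is the phase condition [xi (1 - xi) <= zeta x] multiplied
   by [xi x]. *)
have := ler_wpM2l (mulr_ge0 xi_ge0 x_ge0) lo.
by nra.
Qed.

Lemma terminal_phase : x <= xi * (1 - xi) / zeta -> y <= xi * x.
Proof.
rewrite ler_pdivlMr // => hi; apply: (le_trans y_le).
by have := ler_wpM2l x_ge0 hi; nra.
Qed.

End ScalarPhases.

(** * Properties of the step size and the solver precision *)

Section StepSize.
Variables (R : realType) (gamma Gamma mu2 mun eps : R).
Hypotheses (gamma_gt0 : 0 < gamma) (gamma_le : gamma <= Gamma).
Hypotheses (mu_gt0 : 0 < mu2) (mu_le : mu2 <= mun) (eps_gt0 : 0 < eps).
Hypothesis eps_lt : eps < mu2 / mun * Num.sqrt (gamma / Gamma).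

Let Gamma_gt0 : 0 < Gamma. Proof. exact: lt_le_trans gamma_le. Qed.
Let mun_gt0 : 0 < mun. Proof. exact: lt_le_trans mu_le. Qed.
Let alpha := expR (- eps ^+ 2) / (1 + eps) ^+ 2
               * (gamma / Gamma * (mu2 / mun)) ^+ 2.

Let ratio_bounds : 0 < gamma / Gamma * (mu2 / mun) <= 1.
Proof.
rewrite mulr_gt0 ?divr_gt0 //= mulr_ile1 ?divr_ge0 ?(ltW mu_gt0) ?(ltW mun_gt0)
  ?(ltW gamma_gt0) ?(ltW Gamma_gt0) //.
  by rewrite ler_pdivrMr // mul1r.
by rewrite ler_pdivrMr // mul1r.
Qed.

Lemma step_size_gt0 : 0 < alpha.
Proof.
have /andP[r0 _] := ratio_bounds.
by rewrite mulr_gt0 ?divr_gt0 ?expR_gt0 ?exprn_gt0 // addr_gt0.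
Qed.

Lemma step_size_le1 : alpha <= 1.
Proof.
have /andP[r0 r1] := ratio_bounds.
have e1 : 1 <= (1 + eps) ^+ 2 by rewrite exprn_ege1 // lerDl ltW.
rewrite mulr_ile1 ?divr_ge0 ?expR_ge0 ?sqr_ge0 //.
  rewrite ler_pdivrMr ?(lt_le_trans ltr01) // mul1r (le_trans _ e1) //.
  by rewrite -[1]expR0 ler_expR oppr_le0 sqr_ge0.
by rewrite exprn_ile1 // ltW.
Qed.

Lemma solver_precision_lt1 : eps * (mun / mu2) * Num.sqrt (Gamma / gamma) < 1.
Proof.
have s0 : 0 < Num.sqrt (Gamma / gamma) by rewrite sqrtr_gt0 divr_gt0.
have m0 : 0 < mun / mu2 by rewrite divr_gt0.
rewrite -ltr_pdivlMr // -ltr_pdivlMr // mul1r.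
by rewrite -sqrtrV ?divr_ge0 ?(ltW gamma_gt0) ?(ltW Gamma_gt0) // !invf_div mulrC.
Qed.

(** This makes the quadratic term of the descent estimate at most half of the linear one. *)
Lemma step_size_descent :
  alpha * (Gamma / gamma * (1 + eps) ^+ 2) <= expR (- eps ^+ 2).
Proof.
have /andP[r0 r1] := ratio_bounds.
have -> : alpha * (Gamma / gamma * (1 + eps) ^+ 2) =
    expR (- eps ^+ 2) * ((gamma / Gamma * (mu2 / mun)) * (mu2 / mun)).
  by rewrite /alpha; field; rewrite !gt_eqF // addr_gt0.
rewrite ler_piMr ?expR_ge0 // mulr_ile1 ?divr_ge0 ?(ltW mu_gt0) ?(ltW mun_gt0) //.
  exact: ltW.
by rewrite ler_pdivrMr // mul1r.
Qed.

End StepSize.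

(** * The three phases of convergence *)

Theorem theorem1 (R : realType) (n : nat) (E : {set 'I_n * 'I_n})
    (Phi : 'I_#|E| -> R -> R) (b : 'cV[R]_n)
    (omega gamma Gamma delta eps : R)
    (lam : nat -> 'cV[R]_n) (d : nat -> 'cV[R]_n) (Z : nat -> 'M[R]_n) :
  let L := laplacian R E in
  let mu2 := mu_eig 2 L in
  let mun := mu_eig n L in
  let q := dual Phi b in
  let H := hessian q in
  let B := mun * delta / (gamma * Num.sqrt mu2) in
  let alpha := expR (- eps ^+ 2) / (1 + eps) ^+ 2
               * (gamma / Gamma * (mu2 / mun)) ^+ 2 in
  let xi := Num.sqrt (1 - alpha
               + alpha * eps * (mun / mu2) * Num.sqrt (Gamma / gamma)) in
  let zeta := B * (alpha * Gamma * (1 + eps)) ^+ 2 / (2 * mu2 ^+ 2) in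
  let eta0 := xi * (1 - xi) / zeta in
  let eta1 := (1 - xi) / zeta in
  let g := fun k => gradient q (lam k) in
  let dt := fun k => - (Z k *m g k) in
  (* network *)
  loopless E -> uconnected E -> ~ ubipartite E ->
  0 < omega -> omega <= algebraic_connectivity R E ->
  orth b (ones R n) ->
  (* costs *)
  0 < gamma -> gamma <= Gamma -> 0 < delta ->
  (forall e, cost_ok gamma Gamma delta (Phi e)) ->
  (* Lipschitz continuity of the Hessian for the Laplacian norm *)
  (forall l l' : 'cV[R]_n,
     (op_seminorm L (H l' - H l) <= (B * seminorm L (l' - l))%:E)%E) ->
  (* solver *)
  0 < eps -> eps < mu2 / mun * Num.sqrt (gamma / Gamma) ->
  (forall k, H (lam k) *m d k = - g k) ->
  (forall k, seminorm (H (lam k)) (dt k - d k)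
             <= eps * seminorm (H (lam k)) (d k)) ->
  (forall k v, orth v (ones R n) ->
     expR (- eps ^+ 2) * qform (mp_pinv (H (lam k))) v <= qform (Z k) v
     /\ qform (Z k) v <= expR (eps ^+ 2) * qform (mp_pinv (H (lam k))) v) ->
  (* iteration *)
  (forall k, lam k.+1 = lam k + alpha *: dt k) ->
  forall k : nat,
  [/\ eta1 <= seminorm L (g k) ->
        q (lam k.+1) - q (lam k) <=
        - (1 / 2 * (expR (- (2 * eps ^+ 2)) / (1 + eps) ^+ 2)
           * (gamma ^+ 3 / Gamma ^+ 2) * (mu2 ^+ 2 / mun ^+ 4) * eta1 ^+ 2),
      eta0 <= seminorm L (g k) < eta1 ->
        seminorm L (g k.+1) <= eta1^-1 * seminorm L (g k) ^+ 2 &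
      seminorm L (g k) <= eta0 ->
        seminorm L (g k.+1) <=
        Num.sqrt (1 - alpha
          + alpha * eps * (mun / mu2) * Num.sqrt (Gamma / gamma))
        * seminorm L (g k)].
Proof.
move=> L mu2 mun q H B alpha xi zeta eta0 eta1 g dt.
move=> loopE conE nbip _ _ _ gamma_gt0 gamma_le delta_gt0 costs lipH.
move=> eps_gt0 eps_lt Hd solver1 solver2 iter k.
have n1 := not_ubipartite_gt1 loopE nbip.
have ones0 : ones R n != 0.
  apply/eqP => /colP/(_ (Ordinal n1)); rewrite !mxE => /eqP.
  by rewrite oner_eq0.
have psdL := @laplacian_psd R n E; have symL := @laplacian_sym R n E.
have [mu_gt0 mu_le L_le L_ge] := rayleigh_spectral_gap n1 symL psdL
  ones0 (laplacian_ones R loopE) (fun v => @laplacian_kernel R n E loopE v conE).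
rewrite -/L -/mu2 -/mun in mu_gt0 mu_le L_le L_ge.
have Gamma_gt0 : 0 < Gamma := lt_le_trans gamma_gt0 gamma_le.
have mun_gt0 : 0 < mun := lt_le_trans mu_gt0 mu_le.
have HE l : H l = dual_hessian Phi l := hessian_dual b loopE gamma_gt0 costs l.
pose Hk := H (lam k).
have symH : Hk^T = Hk by rewrite /Hk HE dual_hessian_sym.
have psdH v : 0 <= qform Hk v.
  by rewrite /Hk HE (dual_hessian_psd gamma_gt0 gamma_le costs).
have H_le v : qform Hk v <= gamma^-1 * qform L v.
  by rewrite /Hk HE (dual_hessian_le gamma_gt0 gamma_le costs).
have H_ge v : qform L v <= Gamma * qform Hk v.
  by rewrite /Hk HE (dual_hessian_ge gamma_gt0 gamma_le costs).
have H1 : Hk *m ones R n = 0 by rewrite /Hk HE dual_hessian_ones.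
have kerH v : Hk *m v = 0 -> exists c, v = c *: ones R n.
  by rewrite /Hk HE; exact: (dual_hessian_kernel loopE gamma_gt0 gamma_le costs).
have Hdk : Hk *m d k = - g k := Hd k.
have orth_g : orth (g k) (ones R n).
  rewrite /orth -[g k]opprK -Hdk linearN /= trmx_mul symH mulNmx -mulmxA H1.
  by rewrite mulmx0 oppr0 mxE.
have alpha_gt0 : 0 < alpha by exact: step_size_gt0.
have alpha_le1 : alpha <= 1 by exact: step_size_le1.
have B_gt0 : 0 < B by rewrite divr_gt0 ?mulr_gt0 ?sqrtr_gt0.
have zeta_gt0 : 0 < zeta.
  rewrite /zeta.
  by do ![done | apply: divr_gt0 | apply: mulr_gt0 | apply: exprn_gt0
         | apply: addr_gt0].
(* The upper limit on [eps] is exactly what makes [xi < 1]. *)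
have prec : alpha * eps * (mun / mu2) * Num.sqrt (Gamma / gamma) < alpha.
  have := solver_precision_lt1 gamma_gt0 gamma_le mu_gt0 mu_le eps_lt.
  by rewrite -(ltr_pM2l alpha_gt0) mulr1 !mulrA.
have prec0 : 0 <= alpha * eps * (mun / mu2) * Num.sqrt (Gamma / gamma).
  have r0 : 0 <= mun / mu2 by rewrite divr_ge0 ?ltW.
  have ae0 : 0 <= alpha * eps by rewrite mulr_ge0 ?ltW.
  by apply: mulr_ge0; [exact: mulr_ge0|exact: sqrtr_ge0].
have xi_sqr : xi ^+ 2 =
    1 - alpha + alpha * eps * (mun / mu2) * Num.sqrt (Gamma / gamma).
  by rewrite sqr_sqrtr // addr_ge0 ?subr_ge0.
have xi_ge0 : 0 <= xi by exact: sqrtr_ge0.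
have xi_lt1 : xi < 1.
  by rewrite -(ltr_pXn2r (n := 2)) ?nnegrE // xi_sqr expr1n; lra.
have dtle := qform_approx_direction_le symH psdH Gamma_gt0 H_ge (solver1 k)
  (ltW eps_gt0).
have Dle := newton_decrement_le symH psdL psdH Gamma_gt0 mu_gt0 H_ge L_ge ones0 H1 Hdk.
have Dge := newton_decrement_ge symH psdH gamma_gt0 mu_gt0 mu_le H_le L_le Hdk.
have eta1_gt0 : 0 < eta1 by rewrite divr_gt0 ?subr_gt0.
(* Residual of the linearized step plus linearization error; both later phases follow from this
   recursion. *)
have main : seminorm L (g k.+1) <=
    xi ^+ 2 * seminorm L (g k) + zeta * seminorm L (g k) ^+ 2.
  pose v := alpha *: dt k.
  have lin : seminorm L (gradient q (lam k + v) - gradient q (lam k) - Hk *m v) <=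
      B / 2 * seminorm L v ^+ 2.
    rewrite /Hk HE; apply: (gradient_linearization _ loopE gamma_gt0 costs _ (ltW B_gt0)).
    move=> l l'; apply: op_seminorm_le => //.
    by rewrite -!HE; exact: lipH.
  have -> : g k.+1 = (g k + Hk *m v) +
      (gradient q (lam k + v) - gradient q (lam k) - Hk *m v).
    rewrite /g iter -/v -/(g k).
    by rewrite [_ - Hk *m v]addrC addrA addrK [g k + _]addrC subrK.
  apply: le_trans (seminormD symL psdL _ _) _; apply: lerD.
    rewrite xi_sqr; apply: (seminorm_residual_step symL symH psdL psdH gamma_gt0
      Gamma_gt0 mu_gt0 mu_le H_le H_ge L_le L_ge ones0 H1 Hdk).
    - by rewrite (ltW alpha_gt0).
    - exact: solver1.
    - exact: ltW.
  apply: le_trans lin _; rewrite !(sqr_seminorm psdL) qformZ.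
  (* One [Gamma] comes from the length of the approximate direction, the other from the decrement
     bound; the total coefficient is [zeta]. *)
  apply: le_trans (_ : B / 2 * (alpha ^+ 2 * (Gamma * (1 + eps) ^+ 2 *
     (Gamma / mu2 ^+ 2 * qform L (g k)))) <= _).
    apply: ler_wpM2l; first by rewrite divr_ge0 ?(ltW B_gt0).
    apply: ler_wpM2l; first exact: sqr_ge0.
    apply: le_trans dtle _; apply: ler_wpM2l; last exact: Dle.
    by rewrite mulr_ge0 ?sqr_ge0 ?(ltW Gamma_gt0).
  rewrite le_eqVlt; apply/orP; left; apply/eqP; rewrite /zeta; field.
  by rewrite gt_eqF.
split.
- move=> gk; rewrite iter; set v := alpha *: dt k.
  have D0 := psdH (d k).
  have dq := dual_le_quadratic b loopE gamma_gt0 costs (lam k) v.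
  (* The lower spectral guarantee applies because [g k] is orthogonal to [ones]; on the image of
     [Hk] the pseudoinverse form is the decrement. *)
  have vg : (v^T *m gradient q (lam k)) 0 0 <=
      - (alpha * expR (- eps ^+ 2) * qform Hk (d k)).
    have [+ _] := solver2 k (g k) orth_g.
    have -> : qform (mp_pinv (H (lam k))) (g k) = qform Hk (d k).
      by rewrite -qformN -Hdk (qform_mp_pinv symH ones0 H1 kerH).
    rewrite -/(g k) dotC /v -scalemxAr mulmxN mxE mulmxA mxE -/(qform _ _) => h.
    by rewrite mulrN lerN2 -mulrA ler_pM2l.
  have Lv : qform L v <= alpha ^+ 2 * (Gamma * (1 + eps) ^+ 2 * qform Hk (d k)).
    by rewrite qformZ; apply: ler_wpM2l; [exact: sqr_ge0|exact: dtle].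
  have desc := step_size_descent gamma_gt0 gamma_le mu_gt0 mu_le eps_gt0.
  rewrite -/alpha in desc.
  have half : q (lam k + v) - q (lam k) <=
      - (alpha * expR (- eps ^+ 2) / 2 * qform Hk (d k)).
    apply: le_trans dq _.
    have i0 : 0 < gamma^-1 / 2 by rewrite divr_gt0 ?invr_gt0.
    apply: le_trans (lerD vg (ler_wpM2l (ltW i0) Lv)) _.
    have := ler_wpM2l (mulr_ge0 (ltW alpha_gt0) D0) desc.
    rewrite (_ : alpha * qform Hk (d k) * (alpha * (Gamma / gamma * (1 + eps) ^+ 2))
      = 2 * (gamma^-1 / 2 *
     (alpha ^+ 2 * (Gamma * (1 + eps) ^+ 2 * qform Hk (d k))))); last first.
      by field; rewrite gt_eqF.
    set X := gamma^-1 / 2 * _; lra.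
  apply: le_trans half _; rewrite lerN2.
  have gk2 : eta1 ^+ 2 <= qform L (g k).
    rewrite -(sqr_seminorm psdL) lerXn2r ?nnegrE ?seminorm_ge0 //.
    exact: ltW.
  have ae : 0 < alpha * expR (- eps ^+ 2) / 2.
    by apply: divr_gt0 => //; apply: mulr_gt0 => //; exact: expR_gt0.
  apply: le_trans (ler_wpM2l (ltW ae) Dge).
  have gn : 0 < gamma / mun ^+ 2 by rewrite divr_gt0 ?exprn_gt0.
  apply: le_trans (ler_wpM2l (ltW ae) (ler_wpM2l (ltW gn) gk2)).
  (* One exponential factor comes from [alpha], the other from the solver guarantee. *)
  have -> : - (2 * eps ^+ 2) = - eps ^+ 2 + - eps ^+ 2 by ring.
  rewrite expRD le_eqVlt; apply/orP; left; apply/eqP; rewrite /alpha; field.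
  by rewrite !gt_eqF // addr_gt0.
- move=> /andP[lo _].
  exact: (quadratic_phase xi_ge0 xi_lt1 zeta_gt0 (seminorm_ge0 _ _) main lo).
- move=> hi; rewrite -/xi.
  exact: (terminal_phase zeta_gt0 (seminorm_ge0 _ _) main hi).
Qed.
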